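(* Let $\mathcal{A}\in\mathbb{R}^{\ell\times p\times n}$ and suppose that $m\le\min\{\ell,p\}$ steps of the tensor Lanczos bidiagonalization algorithm have been applied to $\mathcal{A}$, giving $\mathcal{P}_m,\mathcal{Q}_m,\mathcal{B}_m,\vec{\mathcal{R}}_m$ with $$\mathcal{A}\star\mathcal{P}_m=\mathcal{Q}_m\star\mathcal{B}_m,\qquad \mathcal{A}^H\star\mathcal{Q}_m=\mathcal{P}_m\star\mathcal{B}_m^H+\vec{\mathcal{R}}_m\star\vec{\mathcal{E}}_m^H$$ (properties listed in the context). Suppose that the tube $\bm{\beta}_m$ obtained by normalizing $\vec{\mathcal{R}}_m$ is nonvanishing. Then for every $1\le k<m$ there exist $\widetilde{\mathcal{P}}_{k+1}\in\mathbb{R}^{p\times(k+1)\times n}$ and $\widetilde{\mathcal{Q}}_{k+1}\in\mathbb{R}^{\ell\times(k+1)\times n}$ with orthonormal lateral slices, an upper triangular tensor $\widetilde{\mathcal{B}}_{k+1}\in\mathbb{R}^{(k+1)\times(k+1)\times n}$, a lateral slice $\vec{\widetilde{\mathcal{P}}}_{k+2}\in\mathbb{R}^{p\times1\times n}$ that is orthogonal to (the lateral slices of) $\widetilde{\mathcal{P}}_{k+1}$, and a tube $\widetilde{\bm{\beta}}_{k+1}\in\mathbb{R}^{1\times1\times n}$ such that $$\mathcal{A}\star\widetilde{\mathcal{P}}_{k+1}=\widetilde{\mathcal{Q}}_{k+1}\star\widetilde{\mathcal{B}}_{k+1},$$ $$\mathcal{A}^H\star\widetilde{\mathcal{Q}}_{k+1}=\widetilde{\mathcal{P}}_{k+1}\star\widetilde{\mathcal{B}}_{k+1}^H+\widetilde{\bm{\beta}}_{k+1}\star\vec{\widetilde{\mathcal{P}}}_{k+2}\star\vec{\mathcal{E}}_{k+1}^H,$$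 and such that the first $k$ lateral slices of $\widetilde{\mathcal{P}}_{k+1}$ are the first $k$ Ritz lateral slices $\vec{\mathcal{V}}^{\mathcal{A}}_{1,m},\dots,\vec{\mathcal{V}}^{\mathcal{A}}_{k,m}$ of $\mathcal{A}$.
   Context: Third-order real tensors $\mathcal{A}\in\mathbb{R}^{\ell\times p\times n}$ have frontal slices $\mathcal{A}^{(k)}=\mathcal{A}(:,:,k)$. Elements of $\mathbb{R}^{\ell\times 1\times n}$ are called lateral slices and elements of $\mathbb{R}^{1\times1\times n}$ are called tubes. $\widehat{\mathcal{A}}$ denotes the tensor obtained by applying the (unnormalized) discrete Fourier transform of length $n$ to each tube $\mathcal{A}(i,j,:)$. The t-product $\mathcal{C}=\mathcal{A}\star\mathcal{B}$ of $\mathcal{A}\in\mathbb{R}^{\ell\times q\times n}$ and $\mathcal{B}\in\mathbb{R}^{q\times p\times n}$ is the tensor in $\mathbb{R}^{\ell\times p\times n}$ with $\widehat{\mathcal{C}}^{(i)}=\widehat{\mathcal{A}}^{(i)}\widehat{\mathcal{B}}^{(i)}$, $i=1,\dots,n$. The product of a tensor and a tube $\bm b$ multiplies each $\widehat{\mathcal{A}}^{(i)}$ by the scalar $\widehat{\bm b}^{(i)}$, and $\bm b\star\mathcal{A}=\mathcal{A}\star\bm b$. The transpose $\mathcal{A}^H$ is obtained by transposing all frontal slices and reversing the order of slices $2,\dots,n$ (so the frontal slices of $\widehat{\mathcal{A}^H}$ are the conjugate transposes of those of $\widehat{\mathcal{A}}$). The identity tensor $\mathcal{I}_m$ has first frontal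 slice $I_m$ and the others zero. $\vec{\mathcal{E}}_j\in\mathbb{R}^{j\times1\times n}$ (canonical lateral slice) has all entries zero except the first entry of its $j$th tube, which is $1$. Lateral slices $\vec{\mathcal{X}},\vec{\mathcal{Y}}$ are orthogonal if $\vec{\mathcal{X}}^H\star\vec{\mathcal{Y}}=0$; a tensor $\mathcal{X}$ with $j$ lateral slices has orthonormal lateral slices iff $\mathcal{X}^H\star\mathcal{X}=\mathcal{I}_j$. A tensor is upper triangular if its tubes $(i,j)$ with $i>j$ vanish. A tube is nonvanishing if it is not the zero tube. Output of $m$ steps of tensor Lanczos bidiagonalization (run without breakdown): $\mathcal{P}_m\in\mathbb{R}^{p\times m\times n}$ and $\mathcal{Q}_m\in\mathbb{R}^{\ell\times m\times n}$ with orthonormal lateral slices, $\vec{\mathcal{R}}_m\in\mathbb{R}^{p\times1\times n}$ with $\mathcal{P}_m^H\star\vec{\mathcal{R}}_m=0$, and $\mathcal{B}_m\in\mathbb{R}^{m\times m\times n}$ upper bidiagonal (only the tubes $(i,i)$ and $(i,i+1)$ may be nonzero), satisfying the two displayed relations of the claim. The tube $\bm{\beta}_m$ is defined by $\widehat{\bm{\beta}}_m^{(i)}=\|\widehat{\vec{\mathcal{R}}}_m^{(i)}\|_2$, $i=1,\dots,n$. Ritz lateral slices: let $\mathcal{B}_m=\mathcal{U}\star\mathcal{S}\star\mathcal{V}^H$ be a t-SVD of $\mathcal{B}_m$, i.e. $\mathcal{U},\mathcal{S},\mathcal{V}\in\mathbb{R}^{m\times m\times n}$, $\mathcal{U}$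 and $\mathcal{V}$ are orthogonal tensors ($\mathcal{U}^H\star\mathcal{U}=\mathcal{V}^H\star\mathcal{V}=\mathcal{I}_m$), and for each $i$ the factorization $\widehat{\mathcal{B}}_m^{(i)}=\widehat{\mathcal{U}}^{(i)}\widehat{\mathcal{S}}^{(i)}(\widehat{\mathcal{V}}^{(i)})^H$ is a matrix SVD with nonnegative diagonal entries in nonincreasing order. With $\vec{\mathcal{U}}_i,\vec{\mathcal{V}}_i$ the $i$th lateral slices of $\mathcal{U},\mathcal{V}$ and $\bm s_i=\mathcal{S}(i,i,:)$, set $\bm s^{\mathcal{A}}_{i,m}=\bm s_i$, $\vec{\mathcal{U}}^{\mathcal{A}}_{i,m}=\mathcal{Q}_m\star\vec{\mathcal{U}}_i$, $\vec{\mathcal{V}}^{\mathcal{A}}_{i,m}=\mathcal{P}_m\star\vec{\mathcal{V}}_i$. The $\vec{\mathcal{V}}^{\mathcal{A}}_{i,m}$ are called the (right) Ritz lateral slices of $\mathcal{A}$. *)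

(* Defs.v *)
From mathcomp Require Import all_boot all_order all_algebra.
From mathcomp Require Import reals trigo.
From mathcomp Require Import complex ring lra.

Set Implicit Arguments.
Unset Strict Implicit.
Unset Printing Implicit Defensive.

Import Order.TTheory GRing.Theory Num.Theory.

Local Open Scope ring_scope.
Local Open Scope sesquilinear_scope.

(* A third-order tensor is the family of its n frontal slices; indices of
   slices, rows and columns all start at 0. *)
Notation tensor R l p n := {ffun 'I_n -> 'M[R]_(l, p)}.
Notation tube R n := (tensor R 1 1 n).

Section Fourier.
Variables (R : realType) (n : nat).
Implicit Types (l p q : nat).

(* exp(- 2 pi i / n); dft is the unnormalized transform. *)
Definition omega : R[i] :=
  (cos (pi *+ 2 / n%:R) -i* sin (pi *+ 2 / n%:R))%C.

Definition dft l p (A : tensor R l p n) : tensor R[i] l p n :=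
  [ffun k : 'I_n =>
     \sum_(j < n) omega ^+ (j * k) *: map_mx (real_complex R) (A j)].

Definition idft l p (F : tensor R[i] l p n) : tensor R[i] l p n :=
  [ffun j : 'I_n => n%:R^-1 *: \sum_(k < n) omega^-1 ^+ (j * k) *: F k].

(* The real tensor with prescribed Fourier slices.  The real part only serves
   to land in the reals: by of_dftK below, dft (of_dft F) = F whenever F has the
   symmetry conj_sym of transforms of real tensors, whence the expected Fourier
   slices dft_tprod, dft_tscale and dft_tnorm of the operations below. *)
Definition of_dft l p (F : tensor R[i] l p n) : tensor R l p n :=
  [ffun j => map_mx (@complex.Re R) (idft F j)].

Definition ordN (k : 'I_n) : 'I_n :=
  Ordinal (ltn_pmod (n - k) (leq_ltn_trans (leq0n k) (ltn_ord k))).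

Definition conj_sym l p (F : tensor R[i] l p n) : Prop :=
  forall k, F (ordN k) = map_mx Num.conj (F k).

Definition tprod l q p (A : tensor R l q n) (B : tensor R q p n) :
    tensor R l p n :=
  of_dft [ffun k => dft A k *m dft B k].

Definition tscale l p (b : tube R n) (A : tensor R l p n) : tensor R l p n :=
  of_dft [ffun k => dft b k 0 0 *: dft A k].

Definition tadj l p (A : tensor R l p n) : tensor R p l n :=
  [ffun k => (A (ordN k))^T].

Definition tid m : tensor R m m n :=
  [ffun k : 'I_n => ((k == 0 :> nat)%:R)%:M].

(* The canonical lateral slice with j tubes, the last of which is the
   identity tube. *)
Definition ecan j : tensor R j 1 n :=
  [ffun k : 'I_n => \matrix_(i, _) ((k == 0 :> nat) && (i.+1 == j))%:R].

Definition lat l p (A : tensor R l p n) (j : 'I_p) : tensor R l 1 n :=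
  [ffun k => col j (A k)].

Definition tube_of l p (A : tensor R l p n) (i : 'I_l) (j : 'I_p) : tube R n :=
  [ffun k => (A k i j)%:M].

Definition tnorm l (X : tensor R l 1 n) : tube R n :=
  of_dft [ffun k => (sqrtC (\sum_i `|dft X k i 0| ^+ 2))%:M].

End Fourier.

Notation "A ⋆ B" := (tprod A B) (at level 40, left associativity) : ring_scope.

Section Notions.
Variables (R : realType) (n : nat).

Definition lat_orthogonal l (X Y : tensor R l 1 n) : Prop :=
  tadj X ⋆ Y = 0.

Definition orthonormal_lats l j (X : tensor R l j n) : Prop :=
  tadj X ⋆ X = tid R n j.

Definition upper_triangular m (B : tensor R m m n) : Prop :=
  forall i j : 'I_m, (j < i)%N -> tube_of B i j = 0.

Definition upper_bidiagonal m (B : tensor R m m n) : Prop :=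
  forall i j : 'I_m, ~~ ((j == i :> nat) || (j == i.+1 :> nat)) ->
    tube_of B i j = 0.

(* In R[i], 0 <= x and x <= y entail that x, respectively y - x, is real. *)
Definition is_svd m (M U S V : 'M[R[i]]_m) : Prop :=
  [/\ U \is unitarymx /\ V \is unitarymx,
      is_diag_mx S,
      forall i, 0 <= S i i,
      forall i j : 'I_m, (i <= j)%N -> S j j <= S i i
    & M = U *m S *m V^t*].

Definition is_tsvd m (B U S V : tensor R m m n) : Prop :=
  [/\ tadj U ⋆ U = tid R n m,
      tadj V ⋆ V = tid R n m,
      B = U ⋆ S ⋆ tadj V
    & forall k : 'I_n, is_svd (dft B k) (dft U k) (dft S k) (dft V k)].

Definition right_ritz p m (P : tensor R p m n) (V : tensor R m m n)
    (i : 'I_m) : tensor R p 1 n :=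
  P ⋆ lat V i.

End Notions.

Section FourierTheory.
Variables (R : realType) (n : nat).
Implicit Types (l p q : nat).
Local Notation w := (omega R n).

Lemma omegaX k :
  w ^+ k = (cos (pi *+ 2 / n%:R *+ k) -i* sin (pi *+ 2 / n%:R *+ k))%C.
Proof.
rewrite /omega; move: (pi *+ 2 / n%:R) => t.
elim: k => [|k IH]; first by rewrite !mulr0n cos0 sin0 oppr0.
rewrite exprS IH !mulrSr cosD sinD; apply/eqP.
by rewrite eq_complex; apply/andP; split; apply/eqP => /=; ring.
Qed.

Lemma omega_prim : (0 < n)%N -> n.-primitive_root w.
Proof.
move=> n_gt0; have n0 : n%:R != 0 :> R by rewrite pnatr_eq0 -lt0n.
rewrite /primitive_root_of_unity n_gt0; apply/forallP => i.
rewrite unity_rootE; apply/eqP; have [e|ne] := eqVneq i.+1 n; first rewrite e.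
  rewrite omegaX -mulr_natr divfK // cos2pi sin2pi oppr0.
  by apply/eqP.
apply/negbTE; have lt_in : (i.+1 < n)%N by rewrite ltn_neqAle ne ltn_ord.
rewrite omegaX eq_complex negb_and; apply/orP; left => /=.
pose x : R := pi / n%:R *+ i.+1.
have -> : pi *+ 2 / n%:R *+ i.+1 = x *+ 2.
  by rewrite /x mulrnAl -!mulrnA mulnC.
have xI : 0 < x < pi.
  rewrite /x mulrn_wgt0 ?divr_gt0 ?pi_gt0 ?ltr0n //=.
  by rewrite -mulr_natr -mulrA gtr_pMr ?pi_gt0 // mulrC ltr_pdivrMr ?ltr0n //
    mul1r ltr_nat.
have := sin_gt0_pi xI; have := cos2Dsin2 x; rewrite cos_mulr2n.
set c := cos x; set s := sin x => cs s0.
by apply/eqP => /eqP; apply/negP; rewrite lt_eqF //; nra.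
Qed.

Lemma omega_unit k : w ^+ k * (w^*) ^+ k = 1.
Proof.
rewrite -exprMn; suff -> : w * w^* = 1 by rewrite expr1n.
rewrite /omega; move: (pi *+ 2 / n%:R) => t.
apply/eqP; rewrite eq_complex; apply/andP; split; apply/eqP => /=; last by ring.
by rewrite -(cos2Dsin2 t); ring.
Qed.

Lemma omega_neq0 : w != 0.
Proof.
apply/eqP => w0; have := omega_unit 1; rewrite !expr1 w0 mul0r => /eqP.
by rewrite eq_sym oner_eq0.
Qed.

Lemma conj_omega : w^* = w^-1.
Proof.
apply: (mulfI omega_neq0); rewrite mulfV ?omega_neq0 //.
by have := omega_unit 1; rewrite !expr1.
Qed.

Lemma omegaN (j : nat) (k : 'I_n) : w ^+ (j * ordN k) = (w ^+ (j * k))^-1.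
Proof.
have n_gt0 : (0 < n)%N by rewrite (leq_ltn_trans _ (ltn_ord k)).
have w1 := prim_expr_order (omega_prim n_gt0).
rewrite mulnC exprM (prim_expr_mod (omega_prim n_gt0)) -exprM mulnC.
apply: (mulIf (expf_neq0 (j * k) omega_neq0)).
rewrite mulVf ?expf_neq0 ?omega_neq0 // -exprD -mulnDr subnK; last exact: ltnW.
by rewrite mulnC exprM w1 expr1n.
Qed.

Lemma ordNK : involutive (@ordN n).
Proof.
move=> k; apply/val_inj => /=; have kn := ltn_ord k.
have [k0|k_gt0] := posnP k; first by rewrite k0 subn0 modnn subn0 modnn.
rewrite [((n - k) %% n)%N]modn_small; last by rewrite ltn_subrL k_gt0 (leq_trans _ kn).
by rewrite subKn ?modn_small // ltnW.
Qed.

Lemma omega_sum (k l : 'I_n) :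
  \sum_(j < n) w ^+ (j * k) * w^-1 ^+ (j * l) = n%:R *+ (k == l).
Proof.
have n_gt0 : (0 < n)%N by rewrite (leq_ltn_trans _ (ltn_ord k)).
have prim := omega_prim n_gt0; have w1 := prim_expr_order prim.
pose z := w ^+ k / w ^+ l.
have zE j : w ^+ (j * k) * w^-1 ^+ (j * l) = z ^+ j.
  by rewrite exprVn !(mulnC j) !exprM -exprVn -exprMn.
under eq_bigr do rewrite zE.
have [kl|ne] := eqVneq k l.
  have z1 : z = 1 by rewrite /z kl divff // expf_neq0 // omega_neq0.
  under eq_bigr do rewrite z1 expr1n.
  by rewrite sumr_const card_ord mulr1n.
have zn : z ^+ n = 1 by rewrite /z exprMn exprVn -!exprM !(mulnC _ n) !exprM w1
  !expr1n invr1 mulr1.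
have z1 : z - 1 != 0.
  rewrite subr_eq0; apply/eqP => zE1.
  have /eqP : w ^+ k = w ^+ l.
    by rewrite -[LHS](divfK (expf_neq0 l omega_neq0)) -/z zE1 mul1r.
  rewrite (eq_prim_root_expr prim) /= !modn_small // => /eqP /val_inj kl.
  by rewrite kl eqxx in ne.
by apply: (mulfI z1); rewrite -subrX1 zn subrr mulr0n mulr0.
Qed.

Lemma omega_sumC (k l : 'I_n) :
  \sum_(j < n) w ^+ (k * j) * w^-1 ^+ (l * j) = n%:R *+ (k == l).
Proof.
by rewrite -omega_sum; apply: eq_bigr => j _; rewrite ![(_ * j)%N]mulnC.
Qed.

Let n_neq0 (k : 'I_n) : n%:R != 0 :> R[i].
Proof. by rewrite pnatr_eq0 -lt0n (leq_ltn_trans _ (ltn_ord k)). Qed.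

Lemma conj_sym_dft l p (A : tensor R l p n) : conj_sym (dft A).
Proof.
move=> k; apply/matrixP => a b; rewrite !ffunE !mxE !summxE rmorph_sum.
apply: eq_bigr => j _; rewrite !mxE rmorphM /= rmorphXn /= conj_omega exprVn.
by rewrite omegaN; congr (_ * _); apply: esym; exact: conjc_real.
Qed.

Lemma of_dftK l p (F : tensor R[i] l p n) : conj_sym F -> dft (of_dft F) = F.
Proof.
move=> Fsym; have realF j a b : (complex.Re (idft F j a b))%:C%C = idft F j a b.
  apply: RRe_real; apply/CrealP; rewrite !ffunE !mxE !summxE rmorphM /=.
  rewrite fmorphV rmorph_nat rmorph_sum; congr (_ * _).
  rewrite (reindex_inj (inv_inj ordNK)); apply: eq_bigr => k _.
  rewrite !mxE Fsym !mxE !exprVn omegaN invrK rmorphM rmorphXn /= conjCK.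
  by rewrite conj_omega exprVn.
apply/ffunP => k; apply/matrixP => a b; rewrite !ffunE summxE.
under eq_bigr do rewrite ffunE !mxE realF ffunE !mxE summxE mulrCA mulr_sumr.
rewrite -mulr_sumr exchange_big /=.
under eq_bigr => j _ do under eq_bigr => i _ do rewrite mxE mulrA.
under eq_bigr => j _ do rewrite -mulr_suml omega_sum.
rewrite (bigD1 k) //= eqxx mulr1n big1 ?addr0 => [|j /negbTE jk].
  by rewrite mulKf ?(n_neq0 k).
by rewrite eq_sym jk mulr0n mul0r.
Qed.

Lemma dftK l p (A : tensor R l p n) : of_dft (dft A) = A.
Proof.
apply/ffunP => k; apply/matrixP => a b; rewrite !ffunE !mxE summxE.
under eq_bigr do rewrite ffunE !mxE summxE mulr_sumr.
rewrite exchange_big /=.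
under eq_bigr => j _ do under eq_bigr => i _ do rewrite !mxE mulrA mulrC mulrC.
under eq_bigr => j _ do under eq_bigr => i _ do
  rewrite [X in X * _]mulrC.
under eq_bigr => j _ do rewrite -mulr_suml omega_sumC.
rewrite (bigD1 k) //= eqxx mulr1n big1 ?addr0 => [|j /negbTE jk].
  by rewrite mulKf ?(n_neq0 k).
by rewrite jk mulr0n mul0r.
Qed.

Lemma dft_inj l p : injective (@dft R n l p).
Proof. exact: can_inj (@dftK l p). Qed.

Lemma dft_tprod l q p (A : tensor R l q n) (B : tensor R q p n) k :
  dft (A ⋆ B) k = dft A k *m dft B k.
Proof.
rewrite of_dftK ?ffunE // => {}k.
by rewrite [LHS]ffunE [X in map_mx _ X]ffunE !conj_sym_dft map_mxM.
Qed.

Lemma dft_tscale l p (b : tube R n) (A : tensor R l p n) k :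
  dft (tscale b A) k = dft b k 0 0 *: dft A k.
Proof.
rewrite of_dftK ?ffunE // => {}k.
by rewrite [LHS]ffunE [X in map_mx _ X]ffunE !conj_sym_dft map_mxZ mxE.
Qed.

Lemma dft_tadj l p (A : tensor R l p n) k : dft (tadj A) k = (dft A k)^t*.
Proof.
rewrite -map_trmx -conj_sym_dft; apply/matrixP => a b; rewrite !ffunE !mxE !summxE.
rewrite (reindex_inj (inv_inj ordNK)); apply: eq_bigr => j _ /=.
by rewrite ffunE !mxE ordNK omegaN mulnC omegaN mulnC.
Qed.

Lemma dft_tid m k : dft (tid R n m) k = 1%:M.
Proof.
have n_gt0 : (0 < n)%N by rewrite (leq_ltn_trans _ (ltn_ord k)).
apply/matrixP => a b; rewrite !ffunE summxE (bigD1 (Ordinal n_gt0)) //= big1.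
  by rewrite !ffunE !mxE mul0n expr0 mul1r addr0 eqxx mulr1n; case: (a == b).
move=> j /negbTE j0; rewrite -val_eqE /= in j0.
by rewrite !ffunE !mxE j0 mul0rn rmorph0 mulr0.
Qed.

Lemma dft_tnorm l (X : tensor R l 1 n) k :
  dft (tnorm X) k = (sqrtC (\sum_i `|dft X k i 0| ^+ 2))%:M.
Proof.
rewrite of_dftK ?ffunE // => {}k; rewrite [LHS]ffunE [X in map_mx _ X]ffunE.
rewrite map_scalar_mx; congr (_%:M).
transitivity (sqrtC (\sum_i `|dft X k i 0| ^+ 2)).
  by congr sqrtC; apply: eq_bigr => i _; rewrite conj_sym_dft mxE norm_conjC.
apply/esym/conj_Creal/ger0_real; rewrite sqrtC_ge0 sumr_ge0 // => i _.
by rewrite exprn_ge0.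
Qed.

End FourierTheory.

(* Main.v *)
(* In each Fourier slice, truncating the SVD of B_m gives P_k = P_m V_k and
   Q_k = Q_m U_k with A P_k = Q_k S_k and A^H Q_k = P_k S_k^H + R_m e_m^H U_k.
   Normalizing R_m yields the next right vector x, and normalizing the residual
   A x - Q_k Q_k^H A x the next left vector q; the component of A^H q orthogonal
   to P_k and x is then the new remainder.  In slices where R_m or the residual
   vanishes, the Ritz vectors P_m v_{k+1} and Q_m u_{k+1} replace the missing
   directions.  All these choices commute with complex conjugation, so that the
   slices obtained are those of real tensors. *)
Require Import Defs.
From mathcomp Require Import all_boot all_order all_algebra.
From mathcomp Require Import reals complex.

Set Implicit Arguments.
Unset Strict Implicit.
Unset Printing Implicit Defensive.

Import Order.TTheory GRing.Theory Num.Theory.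
Local Open Scope ring_scope.
Local Open Scope sesquilinear_scope.

(** * Truncated singular value decompositions *)

Section Matrix.
Variable C : numClosedFieldType.

Lemma trmxC_mul m n p (A : 'M[C]_(m, n)) (B : 'M[C]_(n, p)) :
  (A *m B)^t* = B^t* *m A^t*.
Proof. by rewrite trmx_mul map_mxM. Qed.

Lemma map_trmxC m n (A : 'M[C]_(m, n)) :
  map_mx Num.conj (A^t* ) = (map_mx Num.conj A)^t*.
Proof. by rewrite map_trmx. Qed.

Lemma trmxC_mxsub m n m' n' (f : 'I_m' -> 'I_m)
    (g : 'I_n' -> 'I_n) (A : 'M[C]_(m, n)) :
  (mxsub f g A)^t* = mxsub g f (A^t*).
Proof. by apply/matrixP => i j; rewrite !mxE. Qed.

(** Column [f j] of a diagonal matrix has its only possible nonzero entry in row [f j], so the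
    product sees only columns of [X] selected by [f]; injectivity keeps [mxsub f f D] diagonal. *)
Lemma mul_colsub_diag (F : pzRingType) l m k (f : 'I_k -> 'I_m)
    (X : 'M[F]_(l, m)) (D : 'M[F]_m) :
  injective f -> is_diag_mx D -> X *m colsub f D = colsub f X *m mxsub f f D.
Proof.
move=> f_inj /is_diag_mxP D0; apply/matrixP => a j; rewrite !mxE.
rewrite (bigD1 (f j)) //= big1 => [|i ij]; last first.
  by rewrite !mxE D0 ?mulr0.
rewrite (bigD1 j) //= big1 => [|i ij]; last first.
  by rewrite !mxE D0 ?mulr0 // val_eqE (inj_eq f_inj).
by rewrite !mxE.
Qed.

Lemma is_diag_trmxC m (D : 'M[C]_m) :
  is_diag_mx D -> is_diag_mx (D^t*).
Proof.
move=> /is_diag_mxP D0; apply/is_diag_mxP => i j ij.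
by rewrite !mxE D0 ?rmorph0 // eq_sym.
Qed.

(** Orthonormality cancels the factor next to the selected singular vectors, and the diagonal middle
    factor then mixes no column outside the selection. The second identity is the same argument for
    the adjoint. *)
Lemma svd_trunc m k (f : 'I_k -> 'I_m)
    (U S V : 'M[C]_m) : injective f -> is_diag_mx S ->
  U^t* *m U = 1%:M -> V^t* *m V = 1%:M ->
  U *m S *m V^t* *m colsub f V = colsub f U *m mxsub f f S /\
  (U *m S *m V^t* )^t* *m colsub f U = colsub f V *m (mxsub f f S)^t*.
Proof.
move=> f_inj Sd U1 V1; rewrite !trmxC_mul trmxCK !mulmx_colsub; split.
  by rewrite -[X in colsub f X]mulmxA V1 mulmx1 -mulmx_colsub mul_colsub_diag.
rewrite -!mulmxA U1 mulmx1 -mulmx_colsub trmxC_mxsub.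
by rewrite mul_colsub_diag // is_diag_trmxC.
Qed.

Lemma gram_colsub m q r (g : 'I_q -> 'I_m)
    (h : 'I_r -> 'I_m) (X : 'M[C]_m) : X^t* *m X = 1%:M ->
  (colsub g X)^t* *m colsub h X = mxsub g h 1%:M.
Proof.
move=> <-; rewrite trmxC_mxsub; apply/matrixP => i j; rewrite !mxE.
by apply: eq_bigr => a _; rewrite !mxE.
Qed.

(** * Normalization of vectors, with a fallback for the zero vector *)

Definition cnorm l (v : 'cV[C]_l) : C :=
  sqrtC (\sum_i `|v i 0| ^+ 2).

Lemma cnorm_eq0 l (v : 'cV[C]_l) :
  (cnorm v == 0) = (v == 0).
Proof.
rewrite sqrtC_eq0 psumr_eq0 => [|i _]; last exact: exprn_ge0.
apply/allP/eqP => [v0|-> i _]; last by rewrite mxE normr0 expr0n /= eqxx.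
apply/matrixP => i j; rewrite ord1 mxE; apply/eqP.
by have := v0 i (mem_index_enum i); rewrite expf_eq0 normr_eq0.
Qed.

Lemma conj_cnorm l (v : 'cV[C]_l) :
  (cnorm v)^* = cnorm v.
Proof.
apply/conj_Creal/ger0_real; rewrite sqrtC_ge0; apply: sumr_ge0 => i _.
exact: exprn_ge0.
Qed.

Lemma cnorm_map_conj l (v : 'cV[C]_l) :
  cnorm (map_mx Num.conj v) = cnorm v.
Proof.
by congr sqrtC; apply: eq_bigr => i _; rewrite mxE norm_conjC.
Qed.

(** The fallback [w] supplies a unit vector when [v] has no direction. It leaves
    [cnorm v *: normalize v w = v] intact, because the coefficient is then zero. *)
Definition normalize l (v w : 'cV[C]_l) : 'cV[C]_l :=
  if v == 0 then w else (cnorm v)^-1 *: v.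

Lemma normalizeK l (v w : 'cV[C]_l) : cnorm v *: normalize v w = v.
Proof.
rewrite /normalize; have [v0|v0] := eqVneq v 0; last first.
  by rewrite scalerA mulfV ?scale1r // cnorm_eq0.
have /eqP -> : cnorm v == 0 by rewrite cnorm_eq0 v0.
by rewrite scale0r v0.
Qed.

Lemma normalize_unit l (v w : 'cV[C]_l) :
  w^t* *m w = 1%:M -> (normalize v w)^t* *m normalize v w = 1%:M.
Proof.
rewrite /normalize -cnorm_eq0 => w1; case: ifPn => // d0.
have d2 : v^t* *m v = (cnorm v ^+ 2)%:M.
  rewrite [LHS]mx11_scalar sqrtCK mxE; congr (_%:M).
  by apply: eq_bigr => i _; rewrite !mxE normCKC.
have -> : ((cnorm v)^-1 *: v)^t* = (cnorm v)^-1 *: v^t*.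
  by apply/matrixP => i j; rewrite !mxE rmorphM fmorphV /= conj_cnorm.
rewrite -scalemxAl -scalemxAr d2 scalerA -invfM -expr2 scale_scalar_mx.
by rewrite mulVf // expf_neq0.
Qed.

Lemma mul_normalize_eq0 l q (M : 'M[C]_(q, l)) (v w : 'cV[C]_l) :
  M *m v = 0 -> M *m w = 0 -> M *m normalize v w = 0.
Proof.
by rewrite /normalize; case: ifP => // _ Mv _; rewrite -scalemxAr Mv scaler0.
Qed.

(** The norm is real and [v] vanishes together with its conjugate, so conjugate slices take the same
    branch. *)
Lemma map_normalize l (v w : 'cV[C]_l) :
  map_mx Num.conj (normalize v w) =
  normalize (map_mx Num.conj v) (map_mx Num.conj w).
Proof.
rewrite /normalize map_mx_eq0; case: ifP => // _.
by rewrite map_mxZ fmorphV /= conj_cnorm cnorm_map_conj.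
Qed.

Lemma row_mx_orthonormal l k q (X : 'M[C]_(l, k)) (Y : 'M[C]_(l, q)) :
  X^t* *m X = 1%:M -> Y^t* *m Y = 1%:M -> X^t* *m Y = 0 ->
  (row_mx X Y)^t* *m row_mx X Y = 1%:M.
Proof.
move=> X1 Y1 XY; have YX : Y^t* *m X = 0.
  by rewrite -[X]trmxCK -trmxC_mul XY trmx0 map_mx0.
rewrite tr_row_mx map_col_mx mul_col_row X1 Y1 XY YX.
by rewrite -scalar_mx_block.
Qed.

(** * One step of bidiagonalization in a single slice *)

Definition next_left l p k (A : 'M[C]_(l, p)) (Q : 'M[C]_(l, k))
  (x : 'cV[C]_p) (y : 'cV[C]_l) : 'M[C]_(l, k + 1) :=
  row_mx Q (normalize (A *m x - Q *m (Q^t* *m (A *m x))) y).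

(** Gram-Schmidt puts the columns of [A *m Pt] in the range of [Qt], with block upper triangular
    coefficients that orthonormality identifies with [Bt]. In turn [Pt *m Bt^t*] is the projection
    of [A^t* *m Qt] onto the range of [Pt]. The first [k] columns already lie in that range, so the
    difference is confined to the last column [r], orthogonal to [Pt]. *)
Lemma bidiag_step l p k (A : 'M[C]_(l, p)) (P : 'M[C]_(p, k))
    (Q : 'M[C]_(l, k)) (S : 'M[C]_k) (c : 'cV[C]_k) (x : 'cV[C]_p)
    (y : 'cV[C]_l) (Pt := row_mx P x) (Qt := next_left A Q x y)
    (Bt := Qt^t* *m (A *m Pt)) :
  P^t* *m P = 1%:M -> Q^t* *m Q = 1%:M ->
  x^t* *m x = 1%:M -> y^t* *m y = 1%:M ->
  P^t* *m x = 0 -> Q^t* *m y = 0 ->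
  (forall i j : 'I_k, (j < i)%N -> S i j = 0) ->
  A *m P = Q *m S -> A^t* *m Q = P *m S^t* + x *m c^t* ->
  [/\ Pt^t* *m Pt = 1%:M, Qt^t* *m Qt = 1%:M,
      forall i j : 'I_(k + 1), (j < i)%N -> Bt i j = 0, A *m Pt = Qt *m Bt
    & let r := (A^t* *m Qt - Pt *m Bt^t* ) *m col_mx 0 1%:M in
      Pt^t* *m r = 0 /\ A^t* *m Qt = Pt *m Bt^t* + r *m (col_mx 0 1%:M)^t*].
Proof.
move=> P1 Q1 x1 y1 Px Qy Su AP AQ.
have Pt1 : Pt^t* *m Pt = 1%:M by exact: row_mx_orthonormal.
pose w := A *m x - Q *m (Q^t* *m (A *m x)); pose q := normalize w y.
have Qw : Q^t* *m w = 0.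
  by rewrite mulmxBr [_ *m (Q *m _)]mulmxA Q1 mul1mx subrr.
have Qt1 : Qt^t* *m Qt = 1%:M.
  apply: row_mx_orthonormal => //; first exact: normalize_unit.
  exact: mul_normalize_eq0.
(* If [w] vanishes, so does the corner entry [cnorm w], and the fallback [y] does not contribute. *)
have APt : A *m Pt =
    Qt *m block_mx S (Q^t* *m (A *m x)) 0 (cnorm w)%:M.
  rewrite mul_row_block mulmx0 addr0 -AP mul_mx_row; congr row_mx.
  by rewrite mul_mx_scalar normalizeK addrC subrK.
have BE : Bt = block_mx S (Q^t* *m (A *m x)) 0 (cnorm w)%:M.
  by rewrite /Bt APt mulmxA Qt1 mul1mx.
split=> //.
- move=> i j; rewrite BE.
  case: (split_ordP i) => i' ->; case: (split_ordP j) => j' -> /= ji.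
  + by rewrite block_mxEul Su.
  + by rewrite !ord1 /= addn0 ltnNge ltnW in ji.
  + by rewrite block_mxEdl mxE.
  + by rewrite !ord1 ltnn in ji.
- by rewrite BE.
have AQt : A^t* *m Qt = row_mx (A^t* *m Q) (A^t* *m q) by exact: mul_mx_row.
(* The hypothesis on [A^t* *m Q] expresses its columns through [P] and [x], so the projector onto
   the range of [Pt] fixes them. *)
have PB : Pt *m Bt^t* =
    row_mx (A^t* *m Q) (Pt *m (Pt^t* *m (A^t* *m q))).
  rewrite !trmxC_mul trmxCK -!mulmxA AQt !mul_mx_row; congr row_mx.
  have -> : A^t* *m Q = Pt *m col_mx (S^t* ) (c^t* ) by rewrite AQ mul_row_col.
  by rewrite [Pt^t* *m _]mulmxA Pt1 mul1mx.
rewrite AQt PB opp_row_mx add_row_mx subrr mul_row_col mul0mx add0r mulmx1.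
split; first by rewrite mulmxBr [_ *m (Pt *m _)]mulmxA Pt1 mul1mx subrr.
rewrite tr_col_mx map_row_mx trmx0 trmx1 map_mx0 map_mx1 mul_mx_row.
by rewrite mulmx0 mulmx1 add_row_mx addr0 subrKC.
Qed.

(** Truncation gives [bidiag_step] a diagonal block [mxsub f f S]. The fallbacks are the Ritz
    vectors of index [last], orthogonal to the selected ones because [f] avoids [last]. *)
Lemma ritz_step l p m k (f : 'I_k -> 'I_m) (last : 'I_m)
    (g := fun _ : 'I_1 => last) (A : 'M[C]_(l, p)) (P : 'M[C]_(p, m))
    (Q : 'M[C]_(l, m)) (U S V : 'M[C]_m) (v : 'cV[C]_p) (e : 'cV[C]_m)
    (x := normalize v (P *m colsub g V))
    (Pt := row_mx (P *m colsub f V) x)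
    (Qt := next_left A (Q *m colsub f U) x (Q *m colsub g U))
    (Bt := Qt^t* *m (A *m Pt))
    (r := (A^t* *m Qt - Pt *m Bt^t* ) *m col_mx 0 1%:M) :
  injective f -> (forall i, f i != last) -> is_diag_mx S ->
  P^t* *m P = 1%:M -> Q^t* *m Q = 1%:M ->
  U^t* *m U = 1%:M -> V^t* *m V = 1%:M -> P^t* *m v = 0 ->
  A *m P = Q *m (U *m S *m V^t* ) ->
  A^t* *m Q = P *m (U *m S *m V^t* )^t* + v *m e^t* ->
  [/\ Pt^t* *m Pt = 1%:M, Qt^t* *m Qt = 1%:M,
      forall i j : 'I_(k + 1), (j < i)%N -> Bt i j = 0, A *m Pt = Qt *m Bt
    & Pt^t* *m r = 0 /\
      A^t* *m Qt = Pt *m Bt^t* + r *m (col_mx 0 1%:M)^t*].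
Proof.
move=> f_inj f_last Sd P1 Q1 U1 V1 Pv AP AQ.
have [BV BU] := svd_trunc f_inj Sd U1 V1.
have gram q r' s l' (X : 'M[C]_(l', q)) (Y : 'M[C]_(q, r')) (Z : 'M[C]_(q, s)) :
    X^t* *m X = 1%:M -> (X *m Y)^t* *m (X *m Z) = Y^t* *m Z.
  by move=> X1; rewrite trmxC_mul -mulmxA [X^t* *m _]mulmxA X1 mul1mx.
have sub_f (X : 'M[C]_m) : X^t* *m X = 1%:M ->
    (colsub f X)^t* *m colsub f X = 1%:M.
  move=> X1; rewrite gram_colsub //.
  by apply/matrixP => i j; rewrite !mxE (inj_eq f_inj).
have sub_g (X : 'M[C]_m) : X^t* *m X = 1%:M ->
    (colsub g X)^t* *m colsub g X = 1%:M.
  move=> X1; rewrite gram_colsub //.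
  by apply/matrixP => i j; rewrite !mxE eqxx !ord1.
have sub_fg (X : 'M[C]_m) : X^t* *m X = 1%:M ->
    (colsub f X)^t* *m colsub g X = 0.
  move=> X1; rewrite gram_colsub //.
  by apply/matrixP => i j; rewrite !mxE (negbTE (f_last i)).
(* The value of [c] comes from writing the remainder [v *m e^t* *m colsub f U] with
   [v = cnorm v *: x]. *)
apply: (@bidiag_step _ _ _ A (P *m colsub f V) (Q *m colsub f U)
  (mxsub f f S) ((cnorm v *: (e^t* *m colsub f U))^t* ) x (Q *m colsub g U)).
- by rewrite gram // sub_f.
- by rewrite gram // sub_f.
- by apply: normalize_unit; rewrite gram // sub_g.
- by rewrite gram // sub_g.
- apply: mul_normalize_eq0; last by rewrite gram // sub_fg.
  by rewrite trmxC_mul -mulmxA Pv mulmx0.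
- by rewrite gram // sub_fg.
- move=> i j ji; rewrite mxE; apply: (is_diag_mxP Sd).
  by apply: contraTneq ji => /val_inj/f_inj ->; rewrite ltnn.
- by rewrite mulmxA AP -mulmxA BV mulmxA.
- rewrite trmxCK -scalemxAr scalemxAl normalizeK mulmxA AQ mulmxDl.
  by rewrite -[P *m _ *m _]mulmxA BU mulmxA -[v *m _ *m _]mulmxA.
Qed.

Lemma map_next_left l p k (A : 'M[C]_(l, p)) (Q : 'M[C]_(l, k)) x y :
  map_mx Num.conj (next_left A Q x y) =
  next_left (map_mx Num.conj A) (map_mx Num.conj Q) (map_mx Num.conj x)
    (map_mx Num.conj y).
Proof.
by rewrite map_row_mx map_normalize map_mxB !map_mxM /= map_trmxC.
Qed.

End Matrix.

(** * Translation of tensor identities into Fourier slices *)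

Section Tensor.
Variables (R : realType) (n : nat).
Implicit Types (l p q : nat).

Lemma eq_dft l p (X Y : tensor R l p n) :
  (forall k, dft X k = dft Y k) -> X = Y.
Proof. by move=> XY; apply: (@dft_inj R n); apply/ffunP. Qed.

Lemma dftE l p (X : tensor R l p n) k i j :
  dft X k i j = \sum_(a < n) omega R n ^+ (a * k) * (X a i j)%:C%C.
Proof. by rewrite ffunE summxE; apply: eq_bigr => a _; rewrite !mxE. Qed.

Lemma dft0 l p k : dft (0 : tensor R l p n) k = 0.
Proof.
apply/matrixP => i j; rewrite dftE mxE big1 // => a _.
by rewrite ffunE mxE rmorph0 mulr0.
Qed.

Lemma dftD l p (X Y : tensor R l p n) k : dft (X + Y) k = dft X k + dft Y k.
Proof.
apply/matrixP => i j; rewrite mxE !dftE -big_split; apply: eq_bigr => a _ /=.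
by rewrite ffunE mxE rmorphD mulrDr.
Qed.

Lemma dft_lat l p (X : tensor R l p n) j k : dft (lat X j) k = col j (dft X k).
Proof.
apply/matrixP => i b; rewrite mxE !dftE; apply: eq_bigr => a _.
by rewrite ffunE mxE.
Qed.

Lemma dft_ecan j k : dft (ecan R n j) k = \col_(i < j) (i.+1 == j)%:R.
Proof.
have n_gt0 : (0 < n)%N by rewrite (leq_ltn_trans _ (ltn_ord k)).
apply/matrixP => a b; rewrite dftE (bigD1 (Ordinal n_gt0)) //= big1.
  by rewrite ffunE !mxE mul0n expr0 mul1r addr0 /= rmorph_nat.
move=> i /negbTE; rewrite -val_eqE /= => i0.
by rewrite ffunE mxE i0 /= rmorph0 mulr0.
Qed.

(** The size [j + 1] exposes the block form used in [bidiag_step]. *)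
Lemma dft_ecanS j k : dft (ecan R n (j + 1)) k = col_mx 0 1%:M.
Proof.
rewrite dft_ecan; apply/matrixP => a b.
case: (split_ordP a) => a' ->; rewrite ?col_mxEu ?col_mxEd !mxE /=.
  by rewrite addn1 eqSS ltn_eqF.
by rewrite !ord1 /= addn0 addn1 eqxx.
Qed.

Lemma tube_of_eq0 l p (X : tensor R l p n) i j :
  (forall k, dft X k i j = 0) -> tube_of X i j = 0.
Proof.
move=> X0; apply: eq_dft => k; rewrite dft0; apply/matrixP => a b.
rewrite dftE [RHS]mxE -[RHS](X0 k) dftE; apply: eq_bigr => c _.
by rewrite ffunE !ord1 mxE mulr1n.
Qed.

Lemma tscale1 l p (X : tensor R l p n) : tscale (tid R n 1) X = X.
Proof.
by apply: eq_dft => k; rewrite dft_tscale dft_tid mxE mulr1n scale1r.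
Qed.

Lemma orthonormal_dft l p (X : tensor R l p n) :
  orthonormal_lats X <-> forall k, (dft X k)^t* *m dft X k = 1%:M.
Proof.
split=> [X1 k|X1]; first by rewrite -dft_tadj -dft_tprod X1 dft_tid.
by apply: eq_dft => k; rewrite dft_tprod dft_tadj dft_tid.
Qed.

(** This turns a slicewise construction into a real tensor, once it is known to commute with
    conjugation. *)
Lemma of_conj_sym l p (F : 'I_n -> 'M[R[i]]_(l, p)) :
  (forall k, F (ordN k) = map_mx Num.conj (F k)) ->
  exists X : tensor R l p n, forall k, dft X k = F k.
Proof.
move=> F_sym; exists (of_dft [ffun k => F k]) => k.
by rewrite of_dftK ?ffunE // => {}k; rewrite !ffunE F_sym.
Qed.

Lemma tprod_eq_dft l p q r (X : tensor R l p n) (Y : tensor R p r n)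
    (Z : tensor R l q n) (W : tensor R q r n) :
  X ⋆ Y = Z ⋆ W <-> forall k, dft X k *m dft Y k = dft Z k *m dft W k.
Proof.
split=> [XY k|XY]; last apply: eq_dft => k.
  by rewrite -[LHS]dft_tprod -[RHS]dft_tprod XY.
by rewrite [LHS]dft_tprod [RHS]dft_tprod.
Qed.

Lemma tadj_tprod_eq0 l p q (X : tensor R l p n) (Y : tensor R l q n) :
  tadj X ⋆ Y = 0 <-> forall k, (dft X k)^t* *m dft Y k = 0.
Proof.
split=> [XY k|XY]; last apply: eq_dft => k.
  by rewrite -dft_tadj -dft_tprod XY dft0.
by rewrite [LHS]dft_tprod dft_tadj XY dft0.
Qed.

Lemma tadj_tprod_eqD l p q r s (X : tensor R l p n) (Y : tensor R l r n)
    (Z : tensor R p q n) (W : tensor R r q n) (E : tensor R p s n)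
    (G : tensor R r s n) :
  tadj X ⋆ Y = Z ⋆ tadj W + E ⋆ tadj G <->
  forall k, (dft X k)^t* *m dft Y k =
    dft Z k *m (dft W k)^t* + dft E k *m (dft G k)^t*.
Proof.
have dftR k : dft (Z ⋆ tadj W + E ⋆ tadj G) k =
    dft Z k *m (dft W k)^t* + dft E k *m (dft G k)^t*.
  rewrite dftD [X in X + _]dft_tprod [X in _ + X]dft_tprod.
  by rewrite [dft (tadj W) k]dft_tadj [dft (tadj G) k]dft_tadj.
have dftL k : dft (tadj X ⋆ Y) k = (dft X k)^t* *m dft Y k.
  by rewrite dft_tprod dft_tadj.
split=> [XY k|XY]; last apply: eq_dft => k.
  by rewrite -dftR -dftL XY.
by rewrite dftL dftR.
Qed.

End Tensor.

(** * Assembly of the slices into real tensors *)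

Theorem theorem9 (R : realType) (l p n m : nat)
  (A : tensor R l p n) (hm : (m <= minn l p)%N)
  (Pm : tensor R p m n) (Qm : tensor R l m n)
  (Bm : tensor R m m n) (Rm : tensor R p 1 n)
  (hP : orthonormal_lats Pm) (hQ : orthonormal_lats Qm)
  (hB : upper_bidiagonal Bm) (hPR : tadj Pm ⋆ Rm = 0)
  (hAP : A ⋆ Pm = Qm ⋆ Bm)
  (hAQ : tadj A ⋆ Qm = Pm ⋆ tadj Bm + Rm ⋆ tadj (ecan R n m))
  (hbeta : tnorm Rm <> 0)
  (U S V : tensor R m m n) (hsvd : is_tsvd Bm U S V)
  (k : nat) (hk1 : (1 <= k)%N) (hkm : (k < m)%N) :
  exists (Pt : tensor R p k.+1 n) (Qt : tensor R l k.+1 n)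
         (Bt : tensor R k.+1 k.+1 n) (pt : tensor R p 1 n) (bt : tube R n),
    [/\ orthonormal_lats Pt /\ orthonormal_lats Qt,
        upper_triangular Bt,
        forall j : 'I_k.+1, lat_orthogonal (lat Pt j) pt,
        A ⋆ Pt = Qt ⋆ Bt /\
        tadj A ⋆ Qt =
          Pt ⋆ tadj Bt + tscale bt pt ⋆ tadj (ecan R n k.+1)
      & forall i : 'I_k,
          lat Pt (widen_ord (leqnSn k) i) =
          right_ritz Pm V (widen_ord (ltnW hkm) i)].
Proof.
(* Indices start at 0, so [last], of value [k], designates the Ritz vector following the first
   [k]. *)
pose f := widen_ord (ltnW hkm); pose last := Ordinal hkm.
pose g := fun _ : 'I_1 => last.
have f_inj : injective f by move=> i j /(congr1 val) ij; apply: val_inj.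
have f_last i : f i != last by rewrite -val_eqE /= ltn_eqF.
(* The size [k + 1] fits [row_mx]; comparing [i] and [j] as naturals lets the last clause survive
   the passage to [k.+1]. *)
suff [Pt [Qt [Bt [r [PQ1 Bu Pr APQ PV]]]]] :
    exists (Pt : tensor R p (k + 1) n) (Qt : tensor R l (k + 1) n)
           (Bt : tensor R (k + 1) (k + 1) n) (r : tensor R p 1 n),
    [/\ orthonormal_lats Pt /\ orthonormal_lats Qt,
        upper_triangular Bt,
        tadj Pt ⋆ r = 0,
        A ⋆ Pt = Qt ⋆ Bt /\
        tadj A ⋆ Qt = Pt ⋆ tadj Bt + r ⋆ tadj (ecan R n (k + 1))
      & forall (i : 'I_k) (j : 'I_(k + 1)), i = j :> nat ->
          lat Pt j = right_ritz Pm V (f i)].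
  move: Pt Qt Bt PQ1 Bu Pr APQ PV; rewrite addn1 => Pt Qt Bt PQ1 Bu Pr APQ PV.
  (* The last slice has to be orthogonal to [Pt] but not of unit norm, so it is the whole remainder,
     with the identity tube as coefficient. *)
  exists Pt, Qt, Bt, r, (tid R n 1); split.
  - exact: PQ1.
  - exact: Bu.
  - move=> j; apply/tadj_tprod_eq0 => b; rewrite dft_lat tr_col map_row.
    by rewrite -row_mul; have /tadj_tprod_eq0 -> := Pr; rewrite row0.
  - by rewrite tscale1; exact: APQ.
  - by move=> i; apply: PV.
have [/orthonormal_dft U1 /orthonormal_dft V1 _ svdB] := hsvd.
move/orthonormal_dft: hP => P1; move/orthonormal_dft: hQ => Q1.
move/tadj_tprod_eq0: hPR => PR; move/tprod_eq_dft: hAP => AP.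
move/tadj_tprod_eqD: hAQ => AQ.
(* Each tensor below is prescribed by its Fourier slices. Products, adjoints, column selections and
   normalizations all commute with conjugation, which gives the required symmetry. *)
have [x xE] : exists x : tensor R p 1 n, forall b, dft x b =
    normalize (dft Rm b) (dft Pm b *m colsub g (dft V b)).
  apply: of_conj_sym => b.
  by rewrite !conj_sym_dft map_normalize map_mxM map_mxsub.
have [Pk PkE] : exists X : tensor R p k n, forall b, dft X b =
    dft Pm b *m colsub f (dft V b).
  by apply: of_conj_sym => b; rewrite !conj_sym_dft map_mxM map_mxsub.
have [Qk QkE] : exists X : tensor R l k n, forall b, dft X b =
    dft Qm b *m colsub f (dft U b).
  by apply: of_conj_sym => b; rewrite !conj_sym_dft map_mxM map_mxsub.
have [Pt PtE] : exists X : tensor R p (k + 1) n, forall b, dft X b =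
    row_mx (dft Pk b) (dft x b).
  by apply: of_conj_sym => b; rewrite !conj_sym_dft map_row_mx.
have [Qt QtE] : exists X : tensor R l (k + 1) n, forall b, dft X b =
    next_left (dft A b) (dft Qk b) (dft x b) (dft Qm b *m colsub g (dft U b)).
  apply: of_conj_sym => b.
  by rewrite !conj_sym_dft map_next_left map_mxM map_mxsub.
have [Bt BtE] : exists X : tensor R (k + 1) (k + 1) n, forall b, dft X b =
    (dft Qt b)^t* *m (dft A b *m dft Pt b).
  by apply: of_conj_sym => b; rewrite !conj_sym_dft !map_mxM map_trmxC.
have [r rE] : exists X : tensor R p 1 n, forall b, dft X b =
    ((dft A b)^t* *m dft Qt b - dft Pt b *m (dft Bt b)^t* ) *m col_mx 0 1%:M.
  apply: of_conj_sym => b; rewrite !conj_sym_dft map_mxM map_mxB !map_mxM.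
  by rewrite !map_trmxC map_col_mx map_mx0 map_mx1.
have step b : [/\ (dft Pt b)^t* *m dft Pt b = 1%:M,
      (dft Qt b)^t* *m dft Qt b = 1%:M,
      forall i j : 'I_(k + 1), (j < i)%N -> dft Bt b i j = 0,
      dft A b *m dft Pt b = dft Qt b *m dft Bt b
    & (dft Pt b)^t* *m dft r b = 0 /\ (dft A b)^t* *m dft Qt b =
        dft Pt b *m (dft Bt b)^t* + dft r b *m (col_mx 0 1%:M)^t*].
  have [_ Sd _ _ BE] := svdB b.
  have := AP b; have := AQ b; rewrite BE => AQb APb.
  rewrite rE BtE QtE PtE xE PkE QkE.
  exact: (ritz_step f_inj f_last Sd (P1 b) (Q1 b) (U1 b) (V1 b) (PR b) APb AQb).
exists Pt, Qt, Bt, r; split.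
- by split; apply/orthonormal_dft => b; case: (step b).
- by move=> i j ji; apply: tube_of_eq0 => b; case: (step b) => _ _ -> //.
- by apply/tadj_tprod_eq0 => b; case: (step b) => _ _ _ _ [].
- split; first by apply/tprod_eq_dft => b; case: (step b).
  apply/tadj_tprod_eqD => b; rewrite dft_ecanS.
  by case: (step b) => _ _ _ _ [].
(* Such a [j] falls in the left block [Pk] of [Pt], whose columns are the Ritz vectors. *)
move=> i j ij; have -> : j = lshift 1 i by apply: val_inj; rewrite /= ij.
apply: eq_dft => b; rewrite dft_lat PtE PkE colKl [RHS]dft_tprod dft_lat.
rewrite !colEsub -mulmx_colsub; congr (_ *m _).
by apply/matrixP => a c; rewrite !mxE.
Qed.
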